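(* For $\lambda>0$, let $u_{\lambda}\in\mathcal{C}^2([0,1])$ be the unique solution of $$-u_{\lambda}''(r)=\frac{\lambda\, e^{-u_{\lambda}(r)}}{\int_0^1 e^{-u_{\lambda}(s)}\,\mathrm{d}s},\quad r\in(0,1),\qquad u_{\lambda}(0)=u_{\lambda}'(0)=0.$$ Then, as $\lambda\to\infty$, $$\int_0^1e^{-u_{\lambda}(s)}\,\mathrm{d}s=\frac{2}{\pi^2}\left(\lambda+4+\frac{4}{\lambda}(1+o_{\lambda})\right)\to\infty .$$ Moreover, for any compact subset $K$ of $[0,1)$ (independent of $\lambda$), $$\lim_{\lambda\to\infty}\lambda^2\left\|u_{\lambda}(r)-U(r)-\pi r\left(\frac{\sin(\pi r)}{\lambda}-\frac{\pi r+2\sin(\pi r)}{\lambda^2}\right)\sec^2\left(\frac{\pi}{2}r\right)\right\|_{\mathcal{C}^1(K)}=0,$$ where $U(r)=2\log\cos\left(\frac{\pi}{2}r\right)$, $r\in[0,1)$, is the unique solution of $-U''(r)=\frac{\pi^2}{2}e^{-U(r)}$ on $(0,1)$ with $U(0)=U'(0)=0$.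
   Context: $o_\lambda$ denotes a quantity tending to $0$ as $\lambda\to\infty$. For a set $K$, $\|f\|_{\mathcal{C}^1(K)}:=\sup_{K}(|f|+|f'|)$, where $f$ is a function of $r$ that is $\mathcal{C}^1$ on $[0,1)$. Existence and uniqueness of the $\mathcal{C}^2([0,1])$ solution $u_\lambda$ for every $\lambda>0$ is a known fact and is taken as given. *)

(* Defs.v *)
From Stdlib Require Export Reals.
From Coquelicot Require Export Coquelicot.

Open Scope R_scope.

(** [is_derive] with [locally x] replaced by its trace on [D]: at an endpoint
    of an interval [D] this is the one-sided derivative, and the values of [f]
    outside [D] are irrelevant. *)
Definition is_derive_in (D : R -> Prop) (f : R -> R) (x l : R) : Prop :=
  filterdiff f (within D (locally x)) (fun y => scal y l).

Definition ex_derive_in (D : R -> Prop) (f : R -> R) (x : R) : Prop :=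
  exists l : R, is_derive_in D f x l.

Definition Derive_in (D : R -> Prop) (f : R -> R) (x : R) : R :=
  iota (is_derive_in D f x).

Definition C2_on (D : R -> Prop) (f : R -> R) : Prop :=
  (forall x, D x -> ex_derive_in D f x) /\
  (forall x, D x -> ex_derive_in D (Derive_in D f) x) /\
  continuous_on D (Derive_in D (Derive_in D f)).

Definition Icc01 (r : R) : Prop := 0 <= r <= 1.
Definition Ico01 (r : R) : Prop := 0 <= r < 1.

Definition mass (u : R -> R) : R := RInt (fun s => exp (- u s)) 0 1.

Definition is_solution (lam : R) (u : R -> R) : Prop :=
  C2_on Icc01 u /\
  (forall r, 0 < r < 1 ->
     - Derive_in Icc01 (Derive_in Icc01 u) r = lam * exp (- u r) / mass u) /\
  u 0 = 0 /\ Derive_in Icc01 u 0 = 0.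

Definition is_limit_solution (V : R -> R) : Prop :=
  C2_on Ico01 V /\
  (forall r, 0 < r < 1 ->
     - Derive_in Ico01 (Derive_in Ico01 V) r = PI ^ 2 / 2 * exp (- V r)) /\
  V 0 = 0 /\ Derive_in Ico01 V 0 = 0.

Definition U (r : R) : R := 2 * ln (cos (PI / 2 * r)).

Definition sec (x : R) : R := / cos x.

(** The supremum is taken in [[0, +oo]], so that it is [0] for empty [K].
    Derivatives are relative to [[0, 1)], hence one-sided at [0]. *)
Definition C1_norm (K : R -> Prop) (f : R -> R) : Rbar :=
  Lub_Rbar (fun y => y = 0 \/
    exists r, K r /\ y = Rabs (f r) + Rabs (Derive_in Ico01 f r)).

Definition remainder (u : R -> R -> R) (lam r : R) : R :=
  u lam r - U r
  - PI * r * (sin (PI * r) / lam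
              - (PI * r + 2 * sin (PI * r)) / lam ^ 2)
    * sec (PI / 2 * r) ^ 2.

(* Main.v *)
(** The substitution [w = exp (u / 2)] turns [- u'' = 2 b^2 exp (- u)] into
    [w'' = - b^2 w], so [u = 2 ln (cos (b r))] with [2 b^2 = lam / mass u]; positivity
    of [w] up to [r = 1] forces [b < PI / 2]. Computing the mass then gives
    [lam = 2 b tan b], that is [b = PI / 2 - atan (2 b / lam)], whence
    [b - PI / 2 = - PI / lam + 2 PI / lam^2 + O (lam^-3)] and the expansion of
    [mass u = lam / (2 b^2)]. The second claim is the Taylor expansion at
    [b = PI / 2], uniform for [r] in a compact subset of [[0, 1)], of
    [2 ln (cos (b r))] and of its [r]-derivative. *)

Require Import Defs.
From Stdlib Require Import Reals Lra.
From Coquelicot Require Import Coquelicot.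

Open Scope R_scope.

(** * Derivatives relative to a subset of the line *)

Lemma within_lim_unique (D : R -> Prop) (x y : R) :
  D x -> is_filter_lim (within D (locally x)) y -> y = x.
Proof.
intros Dx H.
apply eq_close; intros eps.
assert (Hy := H (ball y eps) (locally_ball y eps)).
exact (locally_singleton _ _ Hy Dx).
Qed.

(** [filterdiff] quantifies over every limit of its filter, hence the two side conditions on [x].
    The lemma serves in both directions: from [locally x] to its trace on [D], and back when [D] is
    a neighbourhood of [x]. *)
Lemma filterdiff_filter_le (F G : (R -> Prop) -> Prop) (f l : R -> R) (x : R) :
  (forall P, F P -> G P) -> is_filter_lim F x ->
  (forall y, is_filter_lim G y -> y = x) ->
  filterdiff f F l -> filterdiff f G l.
Proof.
intros FG Fx Gx [Hl Hd]; split; [exact Hl|].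
intros y Hy eps; rewrite (Gx y Hy).
apply FG, (Hd x Fx eps).
Qed.

Lemma is_derive_in_of_is_derive (D : R -> Prop) (f : R -> R) (x l : R) :
  D x -> is_derive f x l -> is_derive_in D f x l.
Proof.
intros Dx.
apply filterdiff_filter_le with x.
- intros P; unfold within; apply filter_imp; tauto.
- now intros P.
- intros y; now apply within_lim_unique.
Qed.

Lemma is_derive_of_is_derive_in (D : R -> Prop) (f : R -> R) (x l : R) :
  locally x D -> is_derive_in D f x l -> is_derive f x l.
Proof.
intros HD.
apply filterdiff_filter_le with x.
- intros P HP; unfold within in HP.
  generalize (filter_and _ _ HD HP); apply filter_imp; tauto.
- intros P HP; unfold within; revert HP; apply filter_imp; tauto.
- intros y Hy; symmetry; now apply is_filter_lim_locally_unique.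
Qed.

Lemma is_derive_in_continuous (D : R -> Prop) (f : R -> R) (x l : R) :
  is_derive_in D f x l -> filterlim f (within D (locally x)) (locally (f x)).
Proof.
intros H.
apply (filterdiff_continuous_aux f).
- now exists (fun y => scal y l).
- intros P HP; unfold within; revert HP; apply filter_imp; tauto.
Qed.

Lemma is_derive_in_ext (D : R -> Prop) (f g : R -> R) (x l : R) :
  D x -> (forall y, D y -> f y = g y) ->
  is_derive_in D f x l -> is_derive_in D g x l.
Proof.
intros Dx E [Hl Hd]; split; [exact Hl|].
intros y Hy eps.
assert (Hxy := within_lim_unique _ _ _ Dx Hy); subst y.
generalize (Hd x Hy eps); unfold within; apply filter_imp.
intros z Hz Dz; rewrite <- !E by assumption; now apply Hz.
Qed.

(** The hypothesis asks only for a right neighbourhood of [x] in [D], so that the left endpoint 0 is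
    covered. Both linear approximations, compared at one point [x + d / 2] of [D], give
    [|l1 - l2| <= eps]. *)
Lemma is_derive_in_unique (D : R -> Prop) (f : R -> R) (x l1 l2 : R) :
  locally x (fun y => x <= y -> D y) ->
  is_derive_in D f x l1 -> is_derive_in D f x l2 -> l1 = l2.
Proof.
intros HD [_ H1] [_ H2].
assert (Fx : is_filter_lim (within D (locally x)) x).
{ intros P HP; unfold within; revert HP; apply filter_imp; tauto. }
apply Req_le_aux; intros eps.
assert (He : 0 < eps / 2) by (destruct eps; simpl; lra).
specialize (H1 x Fx (mkposreal _ He)); specialize (H2 x Fx (mkposreal _ He)).
unfold within in H1, H2.
destruct (filter_and _ _ HD (filter_and _ _ H1 H2)) as [d Hd].
assert (Hy : ball x d (x + d / 2)).
{ unfold ball; simpl; unfold AbsRing_ball, abs, minus, plus, opp; simpl.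
  destruct d as [d dpos]; simpl.
  replace (x + d / 2 + - x) with (d / 2) by ring.
  rewrite Rabs_pos_eq; lra. }
destruct (Hd _ Hy) as [Dy [B1 B2]].
assert (Dy' : D (x + d / 2)) by (apply Dy; destruct d; simpl; lra).
specialize (B1 Dy'); specialize (B2 Dy').
unfold norm, minus, plus, opp, scal in B1, B2; simpl in B1, B2.
unfold abs, mult in B1, B2; simpl in B1, B2.
destruct d as [d dpos]; simpl in *.
replace (x + d / 2 + - x) with (d / 2) in B1, B2 by ring.
rewrite (Rabs_pos_eq (d / 2)) in B1, B2 by lra.
apply Rabs_le_between in B1; apply Rabs_le_between in B2.
apply Rabs_le_between; split; apply Rmult_le_reg_r with (d / 2); nra.
Qed.

Lemma Derive_in_eq (D : R -> Prop) (f : R -> R) (x l : R) :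
  locally x (fun y => x <= y -> D y) ->
  is_derive_in D f x l -> Derive_in D f x = l.
Proof.
intros HD Hl.
apply (iota_unique (V := R_CompleteNormedModule) (is_derive_in D f x)); [|exact Hl].
intros y Hy; now apply is_derive_in_unique with D f x.
Qed.

Lemma is_derive_Derive_in (D : R -> Prop) (f : R -> R) (x : R) :
  locally x D -> ex_derive_in D f x -> is_derive f x (Derive_in D f x).
Proof.
intros HD [l Hl].
rewrite (Derive_in_eq D f x l); [| |exact Hl].
- now apply is_derive_of_is_derive_in with D.
- revert HD; apply filter_imp; tauto.
Qed.

(** * Extension from [0, T] to the whole line *)

(** This is the projection onto [0, T]. Composing with it turns continuity relative to [D] into
    two-sided continuity, endpoints included, without changing values on [0, T]. *)
Definition clamp (T x : R) : R := Rmax 0 (Rmin T x).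

Lemma clamp_bounds (T x : R) : 0 <= T -> 0 <= clamp T x <= T.
Proof. unfold clamp, Rmax, Rmin; repeat destruct Rle_dec; lra. Qed.

Lemma clamp_id (T x : R) : 0 <= x <= T -> clamp T x = x.
Proof. unfold clamp, Rmax, Rmin; repeat destruct Rle_dec; lra. Qed.

Lemma clamp_contracting (T x y : R) : Rabs (clamp T y - clamp T x) <= Rabs (y - x).
Proof.
unfold clamp, Rmax, Rmin, Rabs.
repeat destruct Rle_dec; repeat destruct Rcase_abs; lra.
Qed.

Lemma continuous_comp_clamp (D : R -> Prop) (T : R) (f : R -> R) :
  0 <= T -> (forall x, 0 <= x <= T -> D x) -> continuous_on D f ->
  forall x, continuous (fun x => f (clamp T x)) x.
Proof.
intros HT HD Hf x.
assert (Dc : forall y, D (clamp T y)) by (intros y; apply HD; now apply clamp_bounds).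
apply (filterlim_comp _ _ _ (clamp T) f (locally x) (within D (locally (clamp T x)))
  (locally (f (clamp T x)))); [|now apply Hf].
intros P [d Hd]; exists d; intros y Hy.
apply Hd; [|apply Dc].
unfold ball in *; simpl in *; unfold AbsRing_ball, abs, minus, plus, opp in *; simpl in *.
eapply Rle_lt_trans; [apply clamp_contracting|exact Hy].
Qed.

(** * The Liouville initial value problem *)

Lemma is_derive_zero_constant (f : R -> R) (T : R) :
  (forall x, 0 <= x <= T -> continuous f x) ->
  (forall x, 0 < x < T -> is_derive f x 0) ->
  forall x, 0 <= x <= T -> f x = f 0.
Proof.
intros Hc Hd x Hx.
destruct (MVT_gen f 0 x (fun _ => 0)) as [c [_ E]].
- intros y; rewrite Rmin_left, Rmax_right by lra; intros; apply Hd; lra.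
- intros y; rewrite Rmin_left, Rmax_right by lra; intros.
  apply continuity_pt_filterlim, Hc; lra.
- lra.
Qed.

(** [exp (u / 2)] linearises the equation: by conservation of the energy
    [u'^2 / 2 - 2 b^2 (exp (- u) - 1)] it solves [w'' = - b^2 w]. *)
Lemma liouville_solution (b T : R) (u u1 : R -> R) :
  0 < b ->
  (forall x, 0 <= x <= T -> continuous u x) ->
  (forall x, 0 <= x <= T -> continuous u1 x) ->
  (forall x, 0 < x < T -> is_derive u x (u1 x)) ->
  (forall x, 0 < x < T -> is_derive u1 x (- (2 * b ^ 2 * exp (- u x)))) ->
  u 0 = 0 -> u1 0 = 0 ->
  forall x, 0 <= x <= T -> exp (u x / 2) = cos (b * x).
Proof.
intros Hb Cu Cu1 Du Du1 u0 u10.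
assert (Pu : forall x, 0 <= x <= T -> continuity_pt u x)
  by (intros; apply continuity_pt_filterlim, Cu; lra).
assert (Pu1 : forall x, 0 <= x <= T -> continuity_pt u1 x)
  by (intros; apply continuity_pt_filterlim, Cu1; lra).
assert (Energy : forall x, 0 <= x <= T ->
    u1 x ^ 2 = 4 * b ^ 2 * (exp (- u x) - 1)).
{ intros x Hx.
  assert (E := is_derive_zero_constant
    (fun x => u1 x ^ 2 - 4 * b ^ 2 * (exp (- u x) - 1)) T).
  cbv beta in E; rewrite u0, u10, Ropp_0, exp_0 in E.
  enough (u1 x ^ 2 - 4 * b ^ 2 * (exp (- u x) - 1) = 0) by lra.
  rewrite E; [ring| | |exact Hx].
  - intros y Hy; apply continuity_pt_filterlim; specialize (Pu y Hy);
    specialize (Pu1 y Hy); reg.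
  - intros y Hy; specialize (Du y Hy); specialize (Du1 y Hy).
    assert (DEu : Derive (fun x : R => u x) y = u1 y)
      by now apply is_derive_unique.
    assert (DEu1 : Derive (fun x : R => u1 x) y = - (2 * b ^ 2 * exp (- u y)))
      by now apply is_derive_unique.
    auto_derive.
    + repeat split; eexists; eassumption.
    + rewrite DEu, DEu1; ring. }
(* With [w = exp (u / 2)] one has [w' / b = u1 / (2 * b) * w]. [P] and [Q] say that the vector
   [(w, w' / b)], rotated by the angle [b * x], keeps its initial value [(1, 0)]. In both cases the
   derivative is a multiple of the energy identity. *)
assert (P : forall x, 0 <= x <= T ->
   exp (u x / 2) * cos (b * x) - u1 x / (2 * b) * exp (u x / 2) * sin (b * x) = 1).
{ intros x Hx.
  assert (E := is_derive_zero_constant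
    (fun x => exp (u x / 2) * cos (b * x) - u1 x / (2 * b) * exp (u x / 2) * sin (b * x)) T).
  cbv beta in E; rewrite E; [| | |exact Hx].
  - rewrite u0, u10, Rmult_0_r, sin_0, cos_0; unfold Rdiv; rewrite Rmult_0_l, exp_0; ring.
  - intros y Hy; apply continuity_pt_filterlim; specialize (Pu y Hy);
    specialize (Pu1 y Hy); reg.
  - intros y Hy; specialize (Du y Hy); specialize (Du1 y Hy).
    assert (DEu : Derive (fun x : R => u x) y = u1 y)
      by now apply is_derive_unique.
    assert (DEu1 : Derive (fun x : R => u1 x) y = - (2 * b ^ 2 * exp (- u y)))
      by now apply is_derive_unique.
    assert (En : u1 y ^ 2 = 4 * b ^ 2 * (exp (- u y) - 1)) by (apply Energy; lra).
    auto_derive.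
    + repeat split; eexists; eassumption.
    + rewrite DEu, DEu1.
      apply Rminus_diag_uniq.
      match goal with |- ?l - 0 = 0 => replace l with
       (exp (u y * / 2) * sin (b * y) / (4 * b) * (4 * b ^ 2 * (exp (- u y) - 1) - u1 y ^ 2))
       by (field; lra) end.
      rewrite En; ring. }
assert (Q : forall x, 0 <= x <= T ->
   exp (u x / 2) * sin (b * x) + u1 x / (2 * b) * exp (u x / 2) * cos (b * x) = 0).
{ intros x Hx.
  assert (E := is_derive_zero_constant
    (fun x => exp (u x / 2) * sin (b * x) + u1 x / (2 * b) * exp (u x / 2) * cos (b * x)) T).
  cbv beta in E; rewrite E; [| | |exact Hx].
  - rewrite u0, u10, Rmult_0_r, sin_0, cos_0; unfold Rdiv; rewrite Rmult_0_l, exp_0; ring.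
  - intros y Hy; apply continuity_pt_filterlim; specialize (Pu y Hy);
    specialize (Pu1 y Hy); reg.
  - intros y Hy; specialize (Du y Hy); specialize (Du1 y Hy).
    assert (DEu : Derive (fun x : R => u x) y = u1 y)
      by now apply is_derive_unique.
    assert (DEu1 : Derive (fun x : R => u1 x) y = - (2 * b ^ 2 * exp (- u y)))
      by now apply is_derive_unique.
    assert (En : u1 y ^ 2 = 4 * b ^ 2 * (exp (- u y) - 1)) by (apply Energy; lra).
    auto_derive.
    + repeat split; eexists; eassumption.
    + rewrite DEu, DEu1.
      apply Rminus_diag_uniq.
      match goal with |- ?l - 0 = 0 => replace l with
       (exp (u y * / 2) * cos (b * y) / (4 * b) * (u1 y ^ 2 - 4 * b ^ 2 * (exp (- u y) - 1)))
       by (field; lra) end.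
      rewrite En; ring. }
intros x Hx.
assert (S := sin2_cos2 (b * x)); unfold Rsqr in S.
specialize (P x Hx); specialize (Q x Hx).
set (w := exp (u x / 2)) in *; set (v := u1 x / (2 * b) * w) in *.
set (s := sin (b * x)) in *; set (c := cos (b * x)) in *.
(* Inverting the rotation: [w] is [c] times the left side of [P] plus [s] times that of [Q]. *)
replace w with (w * (s * s + c * c)) by (rewrite S; ring).
replace (w * (s * s + c * c)) with (c * (w * c - v * s) + s * (w * s + v * c)) by ring.
rewrite P, Q; ring.
Qed.

Lemma locally_open_interval (a b x : R) :
  a < x < b -> locally x (fun y => a < y < b).
Proof. intros H; now apply (open_and _ _ (open_gt a) (open_lt b)). Qed.

(** Keeping [T] apart from [D] allows both uses: [T = 1] on [0, 1], and any [T < 1] on [0, 1).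
    Clamping [u] and its derivative supplies the two-sided continuity that [liouville_solution]
    needs at 0 and [T]. *)
Lemma C2_on_solution (D : R -> Prop) (b T : R) (u : R -> R) :
  0 < b -> 0 <= T -> (forall x, 0 <= x <= T -> D x) -> C2_on D u ->
  (forall x, 0 < x < T ->
     - Derive_in D (Derive_in D u) x = 2 * b ^ 2 * exp (- u x)) ->
  u 0 = 0 -> Derive_in D u 0 = 0 ->
  forall x, 0 <= x <= T -> exp (u x / 2) = cos (b * x).
Proof.
intros Hb HT HD [Hu [Hu1 _]] Ode u0 u10 x Hx.
assert (Cu : continuous_on D u).
{ intros y Dy; destruct (Hu y Dy) as [l Hl]; exact (is_derive_in_continuous D u y l Hl). }
assert (Cu1 : continuous_on D (Derive_in D u)).
{ intros y Dy; destruct (Hu1 y Dy) as [l Hl]; exact (is_derive_in_continuous D _ y l Hl). }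
assert (HDl : forall y, 0 < y < T -> locally y D).
{ intros y Hy; generalize (locally_open_interval _ _ _ Hy); apply filter_imp.
  intros z Hz; apply HD; lra. }
assert (Eqc : forall f : R -> R, forall y, 0 < y < T ->
   locally y (fun z => f z = f (clamp T z))).
{ intros f y Hy; generalize (locally_open_interval _ _ _ Hy); apply filter_imp.
  intros z Hz; rewrite clamp_id; lra. }
rewrite <- (clamp_id T x Hx) at 1.
refine (liouville_solution b T (fun x => u (clamp T x)) (fun x => Derive_in D u (clamp T x))
  Hb _ _ _ _ _ _ x Hx); try (rewrite clamp_id by lra; assumption).
- intros y _; now apply (continuous_comp_clamp D).
- intros y _; now apply (continuous_comp_clamp D).
- intros y Hy; rewrite clamp_id by lra.
  apply is_derive_ext_loc with u; [now apply Eqc|].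
  apply is_derive_Derive_in; [now apply HDl|apply Hu, HD; lra].
- intros y Hy; rewrite clamp_id by lra.
  apply is_derive_ext_loc with (Derive_in D u); [now apply Eqc|].
  rewrite <- Ode, Ropp_involutive by assumption.
  apply is_derive_Derive_in; [now apply HDl|apply Hu1, HD; lra].
Qed.

Lemma C2_on_solution_ln (D : R -> Prop) (b T : R) (u : R -> R) :
  0 < b -> 0 <= T -> (forall x, 0 <= x <= T -> D x) -> C2_on D u ->
  (forall x, 0 < x < T ->
     - Derive_in D (Derive_in D u) x = 2 * b ^ 2 * exp (- u x)) ->
  u 0 = 0 -> Derive_in D u 0 = 0 ->
  forall x, 0 <= x <= T -> u x = 2 * ln (cos (b * x)).
Proof.
intros Hb HT HD Cu Ode u0 u10 x Hx.
rewrite <- (C2_on_solution D b T u) by assumption.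
rewrite ln_exp; field.
Qed.

(** * Mass and frequency of the solution *)

Lemma mass_pos (u : R -> R) : continuous_on Icc01 u -> 0 < mass u.
Proof.
intros Cu; unfold mass.
rewrite (RInt_ext _ (fun s => exp (- u (clamp 1 s)))).
- apply RInt_gt_0; [lra|intros; apply exp_pos|].
  intros x _.
  apply (continuous_comp (fun s => - u (clamp 1 s)) exp).
  + apply (continuous_opp (fun s => u (clamp 1 s))), (continuous_comp_clamp Icc01);
       [lra|now intros|exact Cu].
  + apply continuity_pt_filterlim, derivable_continuous_pt, derivable_pt_exp.
- intros x; rewrite Rmin_left, Rmax_right by lra; intros Hx; rewrite clamp_id; lra.
Qed.

Lemma cos_scaled_pos (b x : R) : 0 < b < PI / 2 -> 0 <= x <= 1 -> 0 < cos (b * x).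
Proof. intros Hb Hx; apply cos_gt_0; nra. Qed.

Lemma ex_derive_tan (x : R) : 0 < cos x -> ex_derive (fun x : R => tan x) x.
Proof. intros H; exists (tan x ^ 2 + 1); apply is_derive_tan; lra. Qed.

Lemma Derive_tan (x : R) : 0 < cos x -> Derive (fun x : R => tan x) x = tan x ^ 2 + 1.
Proof. intros H; apply is_derive_unique, is_derive_tan; lra. Qed.

(** The integrand is [1 / cos (b * s) ^ 2 = tan (b * s) ^ 2 + 1], with antiderivative
    [tan (b * s) / b]. *)
Lemma mass_ln_cos (b : R) (u : R -> R) :
  0 < b < PI / 2 -> (forall x, 0 <= x <= 1 -> u x = 2 * ln (cos (b * x))) ->
  mass u = tan b / b.
Proof.
intros Hb Hu; unfold mass.
rewrite (RInt_ext _ (fun s => tan (b * s) ^ 2 + 1)).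
- replace (tan b / b) with (minus (tan (b * 1) / b) (tan (b * 0) / b)).
  2:{ unfold minus, plus, opp; simpl; rewrite Rmult_1_r, Rmult_0_r, tan_0; field; lra. }
  apply is_RInt_unique, (is_RInt_derive (fun s => tan (b * s) / b)).
  + intros x; rewrite Rmin_left, Rmax_right by lra; intros Hx.
    assert (C := cos_scaled_pos b x Hb Hx).
    auto_derive; [now apply ex_derive_tan|rewrite Derive_tan by exact C; field; lra].
  + intros x; rewrite Rmin_left, Rmax_right by lra; intros Hx.
    assert (C := cos_scaled_pos b x Hb Hx).
    apply (ex_derive_continuous (fun s => tan (b * s) ^ 2 + 1)).
    auto_derive; now apply ex_derive_tan.
- intros x; rewrite Rmin_left, Rmax_right by lra; intros Hx.
  assert (C := cos_scaled_pos b x Hb ltac:(lra)).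
  assert (S := sin2_cos2 (b * x)); unfold Rsqr in S.
  rewrite Hu by lra.
  replace (- (2 * ln (cos (b * x)))) with (- ln (cos (b * x)) + - ln (cos (b * x))) by ring.
  rewrite exp_plus, exp_Ropp, exp_ln by exact C.
  change (@eq R (/ cos (b * x) * / cos (b * x)) (tan (b * x) ^ 2 + 1)).
  unfold tan; field_simplify_eq; lra.
Qed.

(** For a given solution the nonlocal factor [lam / mass u] is a positive constant, so [u] solves a
    Liouville equation. Comparing the resulting mass [tan b / b] with the one that defined [b]
    closes the system. *)
Lemma is_solution_explicit (lam : R) (u : R -> R) :
  0 < lam -> is_solution lam u ->
  exists b, 0 < b < PI / 2 /\ b = PI / 2 - atan (2 * b / lam) /\
    mass u = lam / (2 * b ^ 2) /\
    (forall r, 0 <= r <= 1 -> u r = 2 * ln (cos (b * r))).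
Proof.
intros Hl [Cu [Ode [u0 u10]]].
assert (Hm : 0 < mass u).
{ apply mass_pos; intros y Dy.
  destruct (proj1 Cu y Dy) as [l Hd]; exact (is_derive_in_continuous _ u y l Hd). }
set (b := sqrt (lam / mass u / 2)).
assert (Hlm : 0 < lam / mass u) by now apply Rdiv_lt_0_compat.
assert (Hb : 0 < b) by (apply sqrt_lt_R0; lra).
assert (Hb2 : 2 * b ^ 2 = lam / mass u) by (unfold b; rewrite pow2_sqrt; lra).
assert (Ode' : forall x, 0 < x < 1 ->
  - Derive_in Icc01 (Derive_in Icc01 u) x = 2 * b ^ 2 * exp (- u x)).
{ intros x Hx; rewrite Hb2, Ode by exact Hx; field; lra. }
assert (W : forall x, 0 <= x <= 1 -> exp (u x / 2) = cos (b * x))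
  by (apply (C2_on_solution Icc01); try assumption; [lra|now intros]).
assert (Hpi : b < PI / 2).
{ destruct (Rlt_le_dec b (PI / 2)) as [|Hge]; [assumption|exfalso].
  assert (PP := PI_RGT_0).
  assert (Hx : 0 <= PI / 2 / b <= 1).
  { split; [apply Rlt_le, Rdiv_lt_0_compat; lra|].
    apply Rmult_le_reg_r with b; [lra|]; field_simplify; lra. }
  assert (E := W _ Hx).
  replace (b * (PI / 2 / b)) with (PI / 2) in E by (field; lra).
  rewrite cos_PI2 in E.
  assert (X := exp_pos (u (PI / 2 / b) / 2)); lra. }
assert (Hu : forall r, 0 <= r <= 1 -> u r = 2 * ln (cos (b * r)))
  by (apply (C2_on_solution_ln Icc01); try assumption; [lra|now intros]).
assert (M := mass_ln_cos b u (conj Hb Hpi) Hu).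
assert (M2 : mass u = lam / (2 * b ^ 2)) by (rewrite Hb2; field; split; lra).
exists b; repeat split; try assumption.
assert (S : 0 < sin b) by (apply sin_gt_0; lra).
assert (C : 0 < cos b) by (apply cos_gt_0; lra).
assert (T : tan b = lam / (2 * b)).
{ replace (tan b) with (tan b / b * b) by (field; lra).
  rewrite <- M, M2; field; lra. }
(* The cotangent of [b] is [2 * b / lam]; writing it as [tan (PI / 2 - b)] lets [atan] be inverted
   on its principal branch. *)
replace (2 * b / lam) with (tan (PI / 2 - b)).
- rewrite atan_tan by lra; ring.
- unfold tan; rewrite sin_shift, cos_shift.
  replace (2 * b / lam) with (/ (lam / (2 * b))) by (field; lra).
  rewrite <- T; unfold tan; field; lra.
Qed.

(** * Asymptotics of the frequency and of the mass *)

Lemma ex_derive_continuity_pt (f : R -> R) (x : R) : ex_derive f x -> continuity_pt f x.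
Proof. intros H; now apply continuity_pt_filterlim, (ex_derive_continuous f). Qed.

(** Both differences vanish at 0 and have nonnegative derivatives, [y ^ 4 / (1 + y ^ 2)] and
    [y ^ 2 / (1 + y ^ 2)]. *)
Lemma atan_bounds (x : R) : 0 <= x -> x - x ^ 3 / 3 <= atan x <= x.
Proof.
intros Hx; split.
- destruct (MVT_gen (fun y => atan y - y + y ^ 3 / 3) 0 x (fun y => y ^ 4 / (1 + y ^ 2)))
    as [c [_ E]].
  + intros y _; auto_derive; [easy|field; nra].
  + intros y _; apply ex_derive_continuity_pt; auto_derive; easy.
  + rewrite atan_0 in E.
    assert (0 <= c ^ 4 / (1 + c ^ 2) * (x - 0)); [|lra].
    apply Rmult_le_pos; [|lra].
    apply Rmult_le_pos; [|apply Rlt_le, Rinv_0_lt_compat; nra].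
    replace (c ^ 4) with ((c ^ 2) ^ 2) by ring; apply pow2_ge_0.
- destruct (MVT_gen (fun y => y - atan y) 0 x (fun y => y ^ 2 / (1 + y ^ 2)))
    as [c [_ E]].
  + intros y _; auto_derive; [easy|field; nra].
  + intros y _; apply ex_derive_continuity_pt; auto_derive; easy.
  + rewrite atan_0 in E.
    assert (0 <= c ^ 2 / (1 + c ^ 2) * (x - 0)); [|lra].
    apply Rmult_le_pos; [|lra].
    apply Rmult_le_pos; [apply pow2_ge_0|apply Rlt_le, Rinv_0_lt_compat; nra].
Qed.

(** [q] is the defect in [b (1 + 2 / lam) = PI / 2], which would hold exactly
    if [atan] were the identity. *)
Lemma frequency_defect (lam b : R) :
  0 < lam -> 0 < b < PI / 2 -> b = PI / 2 - atan (2 * b / lam) ->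
  exists q, b * (1 + 2 / lam) = PI / 2 + q /\ 0 <= q <= 8 / 3 * (b / lam) ^ 3.
Proof.
intros Hl Hb E.
exists (2 * b / lam - atan (2 * b / lam)).
assert (P : 0 <= 2 * b / lam) by (apply Rlt_le, Rdiv_lt_0_compat; lra).
split.
- replace (b * (1 + 2 / lam)) with (b + 2 * b / lam) by (field; lra); lra.
- assert (A := atan_bounds _ P).
  replace (8 / 3 * (b / lam) ^ 3) with ((2 * b / lam) ^ 3 / 3) by (field; lra).
  lra.
Qed.

(** Everything follows from the exact relation [h * (1 + 2 * e) = q - PI * e] with [q] of order
    [e ^ 3]; the last bound factors a difference of squares. *)
Lemma frequency_expansion (lam b : R) :
  0 < lam -> 0 < b < PI / 2 -> b = PI / 2 - atan (2 * b / lam) ->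
  let e := / lam in let h := b - PI / 2 in
  Rabs h <= 4 * e /\
  Rabs (h - (- PI * e + 2 * PI * e ^ 2)) <= 38 * e ^ 3 /\
  Rabs (h ^ 2 - PI ^ 2 * e ^ 2) <= 64 * e ^ 3 + 176 * e ^ 4.
Proof.
intros Hl Hb E e h.
destruct (frequency_defect lam b Hl Hb E) as [q [Eq [q0 Hq]]].
assert (P4 := PI_4); assert (P0 := PI_RGT_0).
assert (He : 0 < e) by now apply Rinv_0_lt_compat.
assert (Eqe : h * (1 + 2 * e) = q - PI * e).
{ unfold h, e; replace q with (b * (1 + 2 / lam) - PI / 2) by lra; field; lra. }
(* Since [PI <= 4] gives [b < 2], the constant is [8 / 3 * 8], rounded up. *)
assert (Hq' : q <= 22 * e ^ 3).
{ apply Rle_trans with (1 := Hq).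
  replace (b / lam) with (b * e) by reflexivity.
  rewrite Rpow_mult_distr.
  assert (b ^ 3 <= 8) by (replace 8 with (2 ^ 3) by ring; apply pow_incr; lra).
  assert (0 < e ^ 3) by now apply pow_lt.
  nra. }
assert (Hh : - (4 * e) <= h <= 0).
{ assert (A := atan_bounds (2 * b / lam) ltac:(apply Rlt_le, Rdiv_lt_0_compat; lra)).
  split; [|unfold h; lra].
  assert (2 * b / lam <= 4 * e); [|unfold h; lra].
  unfold e, Rdiv; apply Rmult_le_compat_r; [exact (Rlt_le _ _ He)|lra]. }
(* As [1 + 2 * e >= 1], a bound may be checked after multiplication by this factor, where the exact
   relation applies. *)
assert (D : forall x y, 0 <= y -> Rabs (x * (1 + 2 * e)) <= y -> Rabs x <= y).
{ intros x y Hy; rewrite Rabs_mult, (Rabs_pos_eq (1 + 2 * e)) by lra.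
  assert (Hx := Rabs_pos x); nra. }
assert (e2 : 0 < e ^ 2) by now apply pow_lt.
assert (e3 : 0 < e ^ 3) by now apply pow_lt.
assert (Hhe : Rabs (h + PI * e) <= 8 * e ^ 2 + 22 * e ^ 3).
{ apply D; [nra|].
  replace ((h + PI * e) * (1 + 2 * e)) with (q + 2 * PI * e ^ 2)
    by (rewrite Rmult_plus_distr_r, Eqe; ring).
  rewrite Rabs_pos_eq; nra. }
repeat split.
- apply Rabs_le; lra.
- apply D; [nra|].
  replace ((h - (- PI * e + 2 * PI * e ^ 2)) * (1 + 2 * e)) with (q - 4 * PI * e ^ 3)
    by (rewrite Rmult_minus_distr_r, Eqe; ring).
  apply Rabs_le; nra.
- replace (h ^ 2 - PI ^ 2 * e ^ 2) with ((h - PI * e) * (h + PI * e)) by ring.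
  rewrite Rabs_mult.
  replace (64 * e ^ 3 + 176 * e ^ 4) with (8 * e * (8 * e ^ 2 + 22 * e ^ 3)) by ring.
  apply Rmult_le_compat; try apply Rabs_pos; [|exact Hhe].
  apply Rabs_le; nra.
Qed.

(** The three leading terms are exactly [lam * (1 + 2 / lam) ^ 2]. Since [PI / (2 * b)] differs from
    [1 + 2 / lam] by [s = q / b], of order [lam ^ -3], only terms containing [s] remain. *)
Lemma mass_expansion (lam b : R) :
  0 < lam -> 0 < b < PI / 2 -> b = PI / 2 - atan (2 * b / lam) ->
  exists o, lam / (2 * b ^ 2) = 2 / PI ^ 2 * (lam + 4 + 4 / lam * (1 + o)) /\
    Rabs o <= 31 * (/ lam + (/ lam) ^ 2 + (/ lam) ^ 4).
Proof.
intros Hl Hb E.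
destruct (frequency_defect lam b Hl Hb E) as [q [Eq [q0 Hq]]].
assert (P4 := PI_4); assert (P0 := PI_RGT_0).
set (e := / lam); assert (He : 0 < e) by now apply Rinv_0_lt_compat.
set (s := q / b).
assert (Es : PI / (2 * b) = 1 + 2 * e - s).
{ unfold s, e; replace q with (b * (1 + 2 / lam) - PI / 2) by lra; field; lra. }
(* Dividing by [b] leaves [8 / 3 * b ^ 2 <= 32 / 3], rounded up to 11. *)
assert (Hs : 0 <= s <= 11 * e ^ 3).
{ unfold s; split; [apply Rmult_le_pos; [lra|apply Rlt_le, Rinv_0_lt_compat; lra]|].
  apply Rmult_le_reg_r with b; [lra|].
  replace (q / b * b) with q by (field; lra).
  apply Rle_trans with (1 := Hq).
  replace (b / lam) with (b * e) by reflexivity.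
  assert (0 < e ^ 3) by now apply pow_lt.
  replace (8 / 3 * (b * e) ^ 3) with (8 / 3 * b ^ 2 * (e ^ 3 * b)) by ring.
  replace (11 * e ^ 3 * b) with (11 * (e ^ 3 * b)) by ring.
  apply Rmult_le_compat_r; nra. }
(* The witness collects the terms in [s] of [lam * (1 + 2 * e - s) ^ 2], divided by [4 / lam]. *)
exists (lam ^ 2 / 4 * (s ^ 2 - 2 * s * (1 + 2 * e))).
split.
- replace (lam / (2 * b ^ 2)) with (2 / PI ^ 2 * lam * (PI / (2 * b)) ^ 2) by (field; lra).
  rewrite Es; unfold e; field; lra.
- replace lam with (/ e) by (unfold e; now rewrite Rinv_inv).
  rewrite Rabs_mult, Rabs_pos_eq.
  2:{ apply Rmult_le_pos; [apply pow2_ge_0|lra]. }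
  assert (e3 : 0 < e ^ 3) by now apply pow_lt.
  assert (B : Rabs (s ^ 2 - 2 * s * (1 + 2 * e)) <= 22 * e ^ 3 * (1 + 2 * e) + 121 * e ^ 6).
  { replace (121 * e ^ 6) with ((11 * e ^ 3) ^ 2) by ring.
    assert (0 <= s ^ 2 <= (11 * e ^ 3) ^ 2)
      by (split; [apply pow2_ge_0|apply pow_incr; lra]).
    assert (0 <= 2 * s * (1 + 2 * e) <= 22 * e ^ 3 * (1 + 2 * e)) by nra.
    apply Rabs_le; lra. }
  apply Rle_trans with ((/ e) ^ 2 / 4 * (22 * e ^ 3 * (1 + 2 * e) + 121 * e ^ 6)).
  + apply Rmult_le_compat_l; [|exact B].
    apply Rmult_le_pos; [apply pow2_ge_0|lra].
  + replace ((/ e) ^ 2 / 4 * (22 * e ^ 3 * (1 + 2 * e) + 121 * e ^ 6))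
      with (22 / 4 * e + 11 * e ^ 2 + 121 / 4 * e ^ 4) by (field; lra).
    assert (0 < e ^ 2) by now apply pow_lt.
    assert (0 < e ^ 4) by now apply pow_lt.
    lra.
Qed.

(** * Second-order Taylor expansion in the frequency *)

Lemma is_derive_minus_const (f : R -> R) (x l k : R) :
  is_derive f x l -> is_derive (fun y => f y - k) x l.
Proof.
intros H; replace l with (l - 0) by ring.
apply (is_derive_minus f (fun _ => k) x l 0 H), (is_derive_const k).
Qed.

Lemma abs_le_of_derive_bound (g g1 : R -> R) (a c B : R) :
  a <= c -> (forall x, a <= x <= c -> is_derive g x (g1 x)) ->
  (forall x, a <= x <= c -> Rabs (g1 x) <= B) -> g c = 0 ->
  Rabs (g a) <= B * (c - a).
Proof.
intros Hac Hd HB gc.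
destruct (MVT_gen g a c g1) as [x [Hx E]].
- intros x; rewrite Rmin_left, Rmax_right by lra; intros; apply Hd; lra.
- intros x; rewrite Rmin_left, Rmax_right by lra; intros Hx.
  apply ex_derive_continuity_pt; exists (g1 x); now apply Hd.
- rewrite Rmin_left, Rmax_right in Hx by lra.
  replace (g a) with (- (g1 x * (c - a))) by lra.
  rewrite Rabs_Ropp, Rabs_mult, (Rabs_pos_eq (c - a)) by lra.
  apply Rmult_le_compat_r; [lra|now apply HB].
Qed.

(** The mean value bound is applied three times, to [f2], [f1] and [f] with their Taylor polynomials
    subtracted. The base point is the right end because [b] lies below [PI / 2]. The factor 1/6 is
    given up. *)
Lemma taylor2_bound (f f1 f2 f3 : R -> R) (a c M : R) :
  a <= c ->
  (forall x, a <= x <= c -> is_derive f x (f1 x)) ->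
  (forall x, a <= x <= c -> is_derive f1 x (f2 x)) ->
  (forall x, a <= x <= c -> is_derive f2 x (f3 x)) ->
  (forall x, a <= x <= c -> Rabs (f3 x) <= M) ->
  Rabs (f a - f c - f1 c * (a - c) - f2 c * (a - c) ^ 2 / 2) <= M * (c - a) ^ 3.
Proof.
intros Hac D0 D1 D2 HM.
assert (M0 : 0 <= M).
{ apply Rle_trans with (2 := HM a ltac:(lra)); apply Rabs_pos. }
assert (B2 : forall x, a <= x <= c -> Rabs (f2 x - f2 c) <= M * (c - a)).
{ intros x Hx; apply Rle_trans with (M * (c - x)); [|nra].
  apply (abs_le_of_derive_bound (fun y => f2 y - f2 c) f3); [lra| | |ring].
  - intros y Hy; apply is_derive_minus_const, D2; lra.
  - intros y Hy; apply HM; lra. }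
assert (B1 : forall x, a <= x <= c ->
  Rabs (f1 x - f1 c - f2 c * (x - c)) <= M * (c - a) * (c - a)).
{ intros x Hx; apply Rle_trans with (M * (c - a) * (c - x));
    [|apply Rmult_le_compat_l; [apply Rmult_le_pos|]; lra].
  apply (abs_le_of_derive_bound (fun y => f1 y - f1 c - f2 c * (y - c))
    (fun y => f2 y - f2 c)); [lra| | |ring].
  - intros y Hy.
    apply (is_derive_minus (fun y => f1 y - f1 c) (fun y => f2 c * (y - c)) y (f2 y) (f2 c)).
    + apply is_derive_minus_const, D1; lra.
    + auto_derive; [easy|ring].
  - intros y Hy; apply B2; lra. }
replace (M * (c - a) ^ 3) with (M * (c - a) * (c - a) * (c - a)) by ring.
apply (abs_le_of_derive_bound (fun y => f y - f c - f1 c * (y - c) - f2 c * (y - c) ^ 2 / 2)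
    (fun y => f1 y - f1 c - f2 c * (y - c))); [lra| |exact B1|field].
intros y Hy.
apply (is_derive_minus (fun y => f y - f c - f1 c * (y - c)) (fun y => f2 c * (y - c) ^ 2 / 2)
  y (f1 y - f1 c) (f2 c * (y - c))).
- apply (is_derive_minus (fun y => f y - f c) (fun y => f1 c * (y - c)) y (f1 y) (f1 c)).
  + apply is_derive_minus_const, D0; lra.
  + auto_derive; [easy|ring].
- auto_derive; [easy|field].
Qed.

(** The function [f] is left abstract so that one estimate serves both the remainder and its
    [r]-derivative. *)
Lemma frequency_taylor_bound (lam b M : R) (f f1 f2 f3 : R -> R) :
  0 < lam -> 0 < b < PI / 2 -> b = PI / 2 - atan (2 * b / lam) ->
  (forall x, b <= x <= PI / 2 -> is_derive f x (f1 x)) ->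
  (forall x, b <= x <= PI / 2 -> is_derive f1 x (f2 x)) ->
  (forall x, b <= x <= PI / 2 -> is_derive f2 x (f3 x)) ->
  Rabs (f1 (PI / 2)) <= M -> Rabs (f2 (PI / 2)) <= M ->
  (forall x, b <= x <= PI / 2 -> Rabs (f3 x) <= M) ->
  Rabs (f b - f (PI / 2)
    - (f1 (PI / 2) * (- PI / lam + 2 * PI / lam ^ 2)
       + f2 (PI / 2) * (PI ^ 2 / (2 * lam ^ 2)))) <= 200 * M * ((/ lam) ^ 3 + (/ lam) ^ 4).
Proof.
intros Hl Hb E D0 D1 D2 M1 M2 M3.
destruct (frequency_expansion lam b Hl Hb E) as [H1 [H2 H3]].
assert (T := taylor2_bound f f1 f2 f3 b (PI / 2) M ltac:(lra) D0 D1 D2 M3).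
set (e := / lam) in *; set (h := b - PI / 2) in *.
set (A1 := f1 (PI / 2)) in *; set (A2 := f2 (PI / 2)) in *.
assert (He : 0 < e) by now apply Rinv_0_lt_compat.
assert (M0 : 0 <= M) by (apply Rle_trans with (2 := M1); apply Rabs_pos).
assert (e3 : 0 < e ^ 3) by now apply pow_lt.
assert (e4 : 0 < e ^ 4) by now apply pow_lt.
(* The error splits into the Taylor remainder [X] and the errors made in replacing [h] and [h ^ 2]
   by their expansions. *)
set (X := f b - f (PI / 2) - A1 * h - A2 * h ^ 2 / 2) in *.
match goal with |- Rabs ?G <= _ =>
  replace G with (X + A1 * (h - (- PI * e + 2 * PI * e ^ 2))
     + A2 * (h ^ 2 - PI ^ 2 * e ^ 2) * / 2) by (unfold X, e; field; lra) end.
assert (T' : Rabs X <= M * (64 * e ^ 3)).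
{ apply Rle_trans with (1 := T); apply Rmult_le_compat_l; [exact M0|].
  replace (64 * e ^ 3) with ((4 * e) ^ 3) by ring.
  apply pow_incr; apply Rabs_le_between in H1; unfold h in *; lra. }
assert (T1 : Rabs (A1 * (h - (- PI * e + 2 * PI * e ^ 2))) <= M * (38 * e ^ 3))
  by (rewrite Rabs_mult; apply Rmult_le_compat; auto using Rabs_pos).
assert (T2 : Rabs (A2 * (h ^ 2 - PI ^ 2 * e ^ 2)) <= M * (64 * e ^ 3 + 176 * e ^ 4))
  by (rewrite Rabs_mult; apply Rmult_le_compat; auto using Rabs_pos).
assert (0 <= M * e ^ 3) by (apply Rmult_le_pos; lra).
assert (0 <= M * e ^ 4) by (apply Rmult_le_pos; lra).
apply Rabs_le_between in T'; apply Rabs_le_between in T1; apply Rabs_le_between in T2.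
(* The coefficients add up to [64 + 38 + 32] for [e ^ 3] and 88 for [e ^ 4], both below 200. *)
apply Rabs_le; lra.
Qed.

(** [lc r b] is [u lam r] and [lc r (PI / 2)] is [U r]; suffixes denote partial
    derivatives. *)
Definition lc (r y : R) : R := 2 * ln (cos (y * r)).
Definition lc_y (r y : R) : R := - 2 * r * tan (y * r).
Definition lc_yy (r y : R) : R := - 2 * r ^ 2 * (tan (y * r) ^ 2 + 1).
Definition lc_yyy (r y : R) : R := - 4 * r ^ 3 * (tan (y * r) * (tan (y * r) ^ 2 + 1)).
Definition lc_r (r y : R) : R := - 2 * y * tan (y * r).
Definition lc_ry (r y : R) : R := - 2 * tan (y * r) - 2 * (y * r) * (tan (y * r) ^ 2 + 1).
Definition lc_ryy (r y : R) : R :=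
  - 4 * r * (tan (y * r) ^ 2 + 1) - 4 * (y * r ^ 2) * (tan (y * r) * (tan (y * r) ^ 2 + 1)).
Definition lc_ryyy (r y : R) : R :=
  - 12 * r ^ 2 * (tan (y * r) * (tan (y * r) ^ 2 + 1))
  - 4 * (y * r ^ 3) * ((tan (y * r) ^ 2 + 1) * (3 * tan (y * r) ^ 2 + 1)).

(** * Partial derivatives of [lc] and their bounds *)

Ltac derive_tan H :=
  auto_derive;
  [ repeat split; first [exact H | now apply ex_derive_tan]
  | rewrite ?Derive_tan by exact H ].

Lemma is_derive_lc_y (r y : R) :
  0 < cos (y * r) -> is_derive (fun y => lc r y) y (lc_y r y).
Proof.
unfold lc, lc_y; intros H; derive_tan H; unfold tan; field; lra.
Qed.

Lemma is_derive_lc_yy (r y : R) :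
  0 < cos (y * r) -> is_derive (fun y => lc_y r y) y (lc_yy r y).
Proof. unfold lc_y, lc_yy; intros H; derive_tan H; ring. Qed.

Lemma is_derive_lc_yyy (r y : R) :
  0 < cos (y * r) -> is_derive (fun y => lc_yy r y) y (lc_yyy r y).
Proof. unfold lc_yy, lc_yyy; intros H; derive_tan H; ring. Qed.

Lemma is_derive_lc_r_y (r y : R) :
  0 < cos (y * r) -> is_derive (fun y => lc_r r y) y (lc_ry r y).
Proof. unfold lc_r, lc_ry; intros H; derive_tan H; ring. Qed.

Lemma is_derive_lc_ry_y (r y : R) :
  0 < cos (y * r) -> is_derive (fun y => lc_ry r y) y (lc_ryy r y).
Proof. unfold lc_ry, lc_ryy; intros H; derive_tan H; ring. Qed.

Lemma is_derive_lc_ryy_y (r y : R) :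
  0 < cos (y * r) -> is_derive (fun y => lc_ryy r y) y (lc_ryyy r y).
Proof. unfold lc_ryy, lc_ryyy; intros H; derive_tan H; ring. Qed.

Lemma is_derive_lc_r (r y : R) :
  0 < cos (y * r) -> is_derive (fun r => lc r y) r (lc_r r y).
Proof. unfold lc, lc_r; intros H; derive_tan H; unfold tan; field; lra. Qed.

Lemma is_derive_lc_y_r (r y : R) :
  0 < cos (y * r) -> is_derive (fun r => lc_y r y) r (lc_ry r y).
Proof. unfold lc_y, lc_ry; intros H; derive_tan H; ring. Qed.

Lemma is_derive_lc_yy_r (r y : R) :
  0 < cos (y * r) -> is_derive (fun r => lc_yy r y) r (lc_ryy r y).
Proof. unfold lc_yy, lc_ryy; intros H; derive_tan H; ring. Qed.

Lemma Rabs_mult_le (a b A B : R) : Rabs a <= A -> Rabs b <= B -> Rabs (a * b) <= A * B.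
Proof. intros; rewrite Rabs_mult; apply Rmult_le_compat; auto using Rabs_pos. Qed.

Lemma Rabs_minus_le (a b A B : R) : Rabs a <= A -> Rabs b <= B -> Rabs (a - b) <= A + B.
Proof.
intros Ha Hb; apply Rabs_le_between in Ha; apply Rabs_le_between in Hb; apply Rabs_le; lra.
Qed.

(** Each derivative is a polynomial of degree at most 4 in [t = tan (y * r)], with bounded
    coefficients, and powers of [1 + t] dominate it. The constant 36 is [12 + 8 * 3], from
    [lc_ryyy]. *)
Lemma lc_derivatives_bound (r y T : R) :
  0 <= r <= 1 -> 0 <= y <= 2 -> 0 <= tan (y * r) <= T ->
  let M := 36 * (1 + T) ^ 4 in
  Rabs (lc_y r y) <= M /\ Rabs (lc_yy r y) <= M /\ Rabs (lc_yyy r y) <= M /\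
  Rabs (lc_ry r y) <= M /\ Rabs (lc_ryy r y) <= M /\ Rabs (lc_ryyy r y) <= M.
Proof.
unfold lc_y, lc_yy, lc_yyy, lc_ry, lc_ryy, lc_ryyy; cbv zeta.
generalize (tan (y * r)); intros t Hr Hy Ht.
set (p := 1 + t).
assert (Hp : 1 <= p) by (unfold p; lra).
assert (p1 : p <= p ^ 2) by nra.
assert (p2 : p ^ 2 <= p ^ 3) by (assert (X := pow2_ge_0 p); nra).
assert (p3 : p ^ 3 <= p ^ 4) by (assert (0 < p ^ 3) by (apply pow_lt; lra); nra).
assert (p4 : p ^ 4 <= (1 + T) ^ 4) by (apply pow_incr; unfold p; lra).
set (P := (1 + T) ^ 4) in *.
assert (t1 : Rabs t <= P) by (apply Rabs_le; unfold p in *; lra).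
assert (s0 : 1 <= t ^ 2 + 1 <= p ^ 2) by (unfold p; nra).
assert (t2 : Rabs (t ^ 2 + 1) <= P) by (apply Rabs_le; lra).
assert (t3 : Rabs (t * (t ^ 2 + 1)) <= P).
{ apply Rle_trans with (p * p ^ 2); [|lra].
  apply Rabs_mult_le; apply Rabs_le; unfold p in *; lra. }
assert (t4 : Rabs ((t ^ 2 + 1) * (3 * t ^ 2 + 1)) <= 3 * P).
{ apply Rle_trans with (p ^ 2 * (3 * p ^ 2)); [|lra].
  apply Rabs_mult_le; apply Rabs_le; lra. }
assert (r2 : 0 <= r ^ 2 <= 1) by nra.
assert (r3 : 0 <= r ^ 3 <= 1) by nra.
assert (y1 : 0 <= y * r <= 2) by nra.
assert (y2 : 0 <= y * r ^ 2 <= 2) by nra.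
assert (y3 : 0 <= y * r ^ 3 <= 2) by nra.
assert (P0 : 0 <= P) by lra.
assert (Q : forall k K a C, 0 <= C -> Rabs k <= K -> Rabs a <= C * P -> Rabs (k * a) <= K * C * P).
{ intros k K a C HC Hk Ha; rewrite Rmult_assoc; now apply Rabs_mult_le. }
repeat split.
- apply Rle_trans with (2 * 1 * P); [|lra]; apply Q; try lra; apply Rabs_le; lra.
- apply Rle_trans with (2 * 1 * P); [|lra]; apply Q; try lra; apply Rabs_le; lra.
- apply Rle_trans with (4 * 1 * P); [|lra]; apply Q; try lra; apply Rabs_le; lra.
- apply Rle_trans with (2 * 1 * P + 4 * 1 * P); [|lra]; apply Rabs_minus_le; apply Q; try lra;
    apply Rabs_le; lra.
- apply Rle_trans with (4 * 1 * P + 8 * 1 * P); [|lra]; apply Rabs_minus_le; apply Q; try lra;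
    apply Rabs_le; lra.
- apply Rle_trans with (12 * 1 * P + 8 * 3 * P); [|lra]; apply Rabs_minus_le; apply Q; try lra;
    apply Rabs_le; lra.
Qed.

(** * The remainder and its derivative on [0, 1) *)

Lemma locally_right_Ico01 (x : R) :
  Ico01 x -> locally x (fun y => x <= y -> Ico01 y).
Proof.
intros [H0 H1].
generalize (open_lt 1 x H1); apply filter_imp; unfold Ico01; intros y; lra.
Qed.

Lemma cos_lc_pos (y r : R) : 0 < y <= PI / 2 -> Ico01 r -> 0 < cos (y * r).
Proof.
intros Hy [Hr0 Hr1]; assert (P0 := PI_RGT_0); apply cos_gt_0; nra.
Qed.

(** The stated correction is the second-order Taylor polynomial in the frequency at [PI / 2], with
    the increment and its square truncated at [lam ^ -2]. The double angle formula turns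
    [sin (PI * r)] times the squared secant into [2 * tan (PI / 2 * r)]. *)
Lemma remainder_lc (u : R -> R -> R) (lam b r : R) :
  0 < lam -> (forall r, 0 <= r <= 1 -> u lam r = 2 * ln (cos (b * r))) -> Ico01 r ->
  remainder u lam r = lc r b - lc r (PI / 2)
    - (lc_y r (PI / 2) * (- PI / lam + 2 * PI / lam ^ 2)
       + lc_yy r (PI / 2) * (PI ^ 2 / (2 * lam ^ 2))).
Proof.
intros Hl Hu Hr.
assert (P0 := PI_RGT_0).
assert (C := cos_lc_pos (PI / 2) r ltac:(lra) Hr).
unfold remainder; rewrite Hu by (unfold Ico01 in Hr; lra).
unfold U, sec, lc, lc_y, lc_yy.
replace (sin (PI * r)) with (2 * sin (PI / 2 * r) * cos (PI / 2 * r))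
  by (rewrite <- sin_2a; f_equal; field).
replace (tan (PI / 2 * r) ^ 2 + 1) with (/ cos (PI / 2 * r) ^ 2).
- unfold tan; field; lra.
- assert (S := sin2_cos2 (PI / 2 * r)); unfold Rsqr in S.
  unfold tan; field_simplify_eq; lra.
Qed.

(** Differentiating in [r] keeps the shape of [remainder_lc], with [lc_r] in place of [lc], so
    [frequency_taylor_bound] applies again. *)
Lemma is_derive_in_remainder (u : R -> R -> R) (lam b r : R) :
  0 < lam -> 0 < b < PI / 2 ->
  (forall r, 0 <= r <= 1 -> u lam r = 2 * ln (cos (b * r))) -> Ico01 r ->
  is_derive_in Ico01 (remainder u lam) r (lc_r r b - lc_r r (PI / 2)
    - (lc_ry r (PI / 2) * (- PI / lam + 2 * PI / lam ^ 2)
       + lc_ryy r (PI / 2) * (PI ^ 2 / (2 * lam ^ 2)))).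
Proof.
intros Hl Hb Hu Hr.
assert (P0 := PI_RGT_0).
assert (C := cos_lc_pos (PI / 2) r ltac:(lra) Hr).
assert (Cb := cos_lc_pos b r ltac:(lra) Hr).
eapply is_derive_in_ext; [exact Hr|intros y Hy; symmetry; now apply remainder_lc with (b := b)|].
apply is_derive_in_of_is_derive; [exact Hr|].
set (h := - PI / lam + 2 * PI / lam ^ 2); set (k := PI ^ 2 / (2 * lam ^ 2)).
apply (is_derive_minus (fun r => lc r b - lc r (PI / 2))
   (fun r => lc_y r (PI / 2) * h + lc_yy r (PI / 2) * k) r
   (lc_r r b - lc_r r (PI / 2)) (lc_ry r (PI / 2) * h + lc_ryy r (PI / 2) * k)).
- apply (is_derive_minus (fun r => lc r b) (fun r => lc r (PI / 2))); now apply is_derive_lc_r.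
- apply (is_derive_plus (fun r => lc_y r (PI / 2) * h) (fun r => lc_yy r (PI / 2) * k)).
  + apply (is_derive_scal_l (V := R_NormedModule) (fun r => lc_y r (PI / 2)) r (lc_ry r (PI / 2)) h);
    now apply is_derive_lc_y_r.
  + apply (is_derive_scal_l (V := R_NormedModule) (fun r => lc_yy r (PI / 2)) r (lc_ryy r (PI / 2)) k);
    now apply is_derive_lc_yy_r.
Qed.

(** Uniformity in [r] comes from monotonicity of [tan]: for [y <= PI / 2] the argument [y * r] stays
    below [PI / 2 * rho < PI / 2]. The constant is [2 * 200 * 36]. *)
Lemma remainder_C1_bound (u : R -> R -> R) (lam rho r : R) :
  0 < lam -> is_solution lam (u lam) -> rho < 1 -> 0 <= r <= rho ->
  Rabs (remainder u lam r) + Rabs (Derive_in Ico01 (remainder u lam) r)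
    <= 14400 * (1 + tan (PI / 2 * rho)) ^ 4 * ((/ lam) ^ 3 + (/ lam) ^ 4).
Proof.
intros Hl Hs Hrho Hr.
destruct (is_solution_explicit lam (u lam) Hl Hs) as [b [Hb [Eb [_ Hu]]]].
assert (P0 := PI_RGT_0); assert (P4 := PI_4).
assert (Ir : Ico01 r) by (unfold Ico01; lra).
assert (C : forall y, b <= y <= PI / 2 -> 0 < cos (y * r))
  by (intros y Hy; apply cos_lc_pos; [lra|exact Ir]).
set (M := 36 * (1 + tan (PI / 2 * rho)) ^ 4).
assert (T : forall y, b <= y <= PI / 2 -> 0 <= tan (y * r) <= tan (PI / 2 * rho)).
{ intros y Hy.
  assert (X : 0 <= y * r <= PI / 2 * rho).
  { split; [apply Rmult_le_pos; lra|apply Rmult_le_compat; lra]. }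
  assert (X' : PI / 2 * rho < PI / 2) by nra.
  split.
  - rewrite <- tan_0; destruct (Req_dec 0 (y * r)) as [<-|]; [lra|].
    apply Rlt_le, tan_increasing; lra.
  - destruct (Req_dec (y * r) (PI / 2 * rho)) as [->|]; [lra|].
    apply Rlt_le, tan_increasing; lra. }
assert (B := fun y (Hy : b <= y <= PI / 2) =>
  lc_derivatives_bound r y (tan (PI / 2 * rho)) ltac:(lra)
   ltac:(lra) (T y Hy)); cbv zeta in B; fold M in B.
assert (Bc := B (PI / 2) ltac:(lra)).
rewrite (Derive_in_eq Ico01 _ r _ (locally_right_Ico01 r Ir)
  (is_derive_in_remainder u lam b r Hl Hb Hu Ir)).
rewrite (remainder_lc u lam b r Hl Hu Ir).
assert (E1 := frequency_taylor_bound lam b M (lc r) (lc_y r) (lc_yy r) (lc_yyy r)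
  Hl Hb Eb (fun y Hy => is_derive_lc_y r y (C y Hy))
  (fun y Hy => is_derive_lc_yy r y (C y Hy)) (fun y Hy => is_derive_lc_yyy r y (C y Hy))
  ltac:(tauto) ltac:(tauto) (fun y Hy => ltac:(destruct (B y Hy); tauto))).
assert (E2 := frequency_taylor_bound lam b M (lc_r r) (lc_ry r) (lc_ryy r) (lc_ryyy r)
  Hl Hb Eb (fun y Hy => is_derive_lc_r_y r y (C y Hy))
  (fun y Hy => is_derive_lc_ry_y r y (C y Hy)) (fun y Hy => is_derive_lc_ryy_y r y (C y Hy))
  ltac:(tauto) ltac:(tauto) (fun y Hy => ltac:(destruct (B y Hy); tauto))).
replace (14400 * (1 + tan (PI / 2 * rho)) ^ 4) with (200 * M + 200 * M) by (unfold M; ring).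
rewrite Rmult_plus_distr_r; now apply Rplus_le_compat.
Qed.

(** * Limits at infinity, the norm and compact sets *)

Lemma is_lim_comp_inv (g : R -> R) :
  ex_derive g 0 -> is_lim (fun lam => g (/ lam)) p_infty (g 0).
Proof.
intros Hg; apply (is_lim_comp_continuous Rinv g).
- apply (is_lim_inv (fun y => y) p_infty p_infty); [apply is_lim_id|easy].
- now apply (ex_derive_continuous g).
Qed.

(** With the bound written in [/ lam], the limit at infinity reduces to continuity of [g] at 0. *)
Lemma is_lim_zero_of_bound (f g : R -> R) :
  (forall lam, 0 < lam -> Rabs (f lam) <= g (/ lam)) -> ex_derive g 0 -> g 0 = 0 ->
  is_lim f p_infty 0.
Proof.
intros Hf Hg g0.
assert (L := is_lim_comp_inv g Hg); rewrite g0 in L.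
apply (is_lim_le_le_loc (fun lam => - g (/ lam)) (fun lam => g (/ lam))).
- exists 0; intros lam Hl; apply Rabs_le_between; now apply Hf.
- rewrite <- Ropp_0; exact (is_lim_opp _ _ _ L).
- exact L.
Qed.

(** The element 0 of the set excludes the value [m_infty], and the upper bound [B] excludes
    [p_infty]. *)
Lemma C1_norm_bound (K : R -> Prop) (f : R -> R) (B : R) :
  0 <= B -> (forall r, K r -> Rabs (f r) + Rabs (Derive_in Ico01 f r) <= B) ->
  is_finite (C1_norm K f) /\ 0 <= real (C1_norm K f) <= B.
Proof.
intros B0 HB; unfold C1_norm.
match goal with |- context [Lub_Rbar ?E] => destruct (Lub_Rbar_correct E) as [Ub Lub];
  set (L := Lub_Rbar E) in * end.
assert (L0 : Rbar_le 0 L) by (apply Ub; now left).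
assert (LB : Rbar_le L B).
{ apply Lub; intros x [->|[r [Kr ->]]]; [exact B0|now apply HB]. }
destruct L as [l| |]; [split; [easy|now split]|easy|easy].
Qed.

(** A compact set is closed, so some disc around the point 1 misses [K]. *)
Lemma compact_below_one (K : R -> Prop) :
  compact K -> (forall r, K r -> 0 <= r < 1) ->
  exists rho, 0 <= rho < 1 /\ forall r, K r -> 0 <= r <= rho.
Proof.
intros HK H.
destruct (compact_P2 K HK 1) as [[d dpos] Hd].
{ intros K1; specialize (H 1 K1); lra. }
(* The maximum keeps [rho] nonnegative when the radius exceeds 1. *)
exists (Rmax 0 (1 - d)); split.
- split; [apply Rmax_l|apply Rmax_lub_lt; lra].
- intros r Kr; specialize (H r Kr); split; [lra|].
  destruct (Rle_lt_dec r (1 - d)) as [Hle|Hlt].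
  + apply Rle_trans with (1 := Hle); apply Rmax_r.
  + exfalso; apply (Hd r); [|exact Kr].
    unfold disc; simpl; apply Rabs_lt_between; lra.
Qed.

(** * The limit problem *)

Lemma is_derive_in_U (r : R) :
  Ico01 r -> is_derive_in Ico01 U r (lc_r r (PI / 2)).
Proof.
intros Hr; apply is_derive_in_of_is_derive; [exact Hr|].
apply is_derive_lc_r, cos_lc_pos; [|exact Hr].
assert (P0 := PI_RGT_0); lra.
Qed.

Lemma is_derive_in_Derive_in_U (r : R) :
  Ico01 r ->
  is_derive_in Ico01 (Derive_in Ico01 U) r (- (PI ^ 2 / 2 * (tan (PI / 2 * r) ^ 2 + 1))).
Proof.
intros Hr.
apply is_derive_in_ext with (fun r => lc_r r (PI / 2)); [exact Hr| |].
- intros y Hy; symmetry; apply Derive_in_eq; [now apply locally_right_Ico01|].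
  now apply is_derive_in_U.
- apply is_derive_in_of_is_derive; [exact Hr|].
  assert (P0 := PI_RGT_0).
  assert (H := cos_lc_pos (PI / 2) r ltac:(lra) Hr).
  unfold lc_r; derive_tan H; field.
Qed.

Lemma is_limit_solution_U : is_limit_solution U.
Proof.
assert (P0 := PI_RGT_0).
assert (D2 : forall r, Ico01 r -> Derive_in Ico01 (Derive_in Ico01 U) r
   = - (PI ^ 2 / 2 * (tan (PI / 2 * r) ^ 2 + 1))).
{ intros r Hr; apply Derive_in_eq; [now apply locally_right_Ico01|].
  now apply is_derive_in_Derive_in_U. }
repeat split.
- intros r Hr; exists (lc_r r (PI / 2)); now apply is_derive_in_U.
- intros r Hr; eexists; now apply is_derive_in_Derive_in_U.
- intros r Hr.
  assert (H := cos_lc_pos (PI / 2) r ltac:(lra) Hr).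
  eapply is_derive_in_continuous.
  eapply is_derive_in_ext; [exact Hr|intros y Hy; symmetry; now apply D2|].
  apply is_derive_in_of_is_derive; [exact Hr|].
  derive_tan H; reflexivity.
- intros r Hr.
  assert (Ir : Ico01 r) by (unfold Ico01; lra).
  assert (C := cos_lc_pos (PI / 2) r ltac:(lra) Ir).
  rewrite D2, Ropp_involutive by exact Ir; f_equal.
  unfold U.
  replace (- (2 * ln (cos (PI / 2 * r))))
    with (- ln (cos (PI / 2 * r)) + - ln (cos (PI / 2 * r))) by ring.
  rewrite exp_plus, exp_Ropp, exp_ln by exact C.
  assert (S := sin2_cos2 (PI / 2 * r)); unfold Rsqr in S.
  unfold tan; field_simplify_eq; lra.
- unfold U; rewrite Rmult_0_r, cos_0, ln_1; ring.
- rewrite (Derive_in_eq Ico01 U 0 (lc_r 0 (PI / 2))).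
  + unfold lc_r; rewrite Rmult_0_r, tan_0; ring.
  + apply locally_right_Ico01; unfold Ico01; lra.
  + apply is_derive_in_U; unfold Ico01; lra.
Qed.

(** This is the Liouville problem with [b = PI / 2], solved on [0, r] for each [r < 1]. *)
Lemma is_limit_solution_unique (V : R -> R) :
  is_limit_solution V -> forall r, 0 <= r < 1 -> V r = U r.
Proof.
intros [C2 [Ode [V0 V10]]] r Hr.
assert (P0 := PI_RGT_0).
apply (C2_on_solution_ln Ico01 (PI / 2) r); try assumption; try lra.
- unfold Ico01; intros x Hx; lra.
- intros x Hx; rewrite Ode by lra; field.
Qed.

Theorem theorem2p1 (u : R -> R -> R)
    (Hu : forall lam : R, 0 < lam -> is_solution lam (u lam)) :
  (exists o : R -> R,
     is_lim o p_infty 0 /\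
     forall lam : R, 0 < lam ->
       mass (u lam) = 2 / PI ^ 2 * (lam + 4 + 4 / lam * (1 + o lam))) /\
  is_lim (fun lam => mass (u lam)) p_infty p_infty /\
  (forall K : R -> Prop, compact K -> (forall r, K r -> 0 <= r < 1) ->
     (forall lam : R, 0 < lam -> is_finite (C1_norm K (remainder u lam))) /\
     is_lim (fun lam => lam ^ 2 * real (C1_norm K (remainder u lam)))
       p_infty 0) /\
  is_limit_solution U /\
  (forall V : R -> R, is_limit_solution V ->
     forall r, 0 <= r < 1 -> V r = U r).
Proof.
assert (P0 := PI_RGT_0); assert (P4 := PI_4).
split; [|split; [|split; [|split]]].
(* Solving the expansion for [o] defines it as a function of [lam] without choice; it agrees with
   the value from [mass_expansion] at each [lam > 0]. *)
- exists (fun lam => (mass (u lam) * (PI ^ 2 / 2) - lam - 4) * lam / 4 - 1); split.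
  + apply (is_lim_zero_of_bound _ (fun e => 31 * (e + e ^ 2 + e ^ 4))).
    * intros lam Hl.
      destruct (is_solution_explicit lam (u lam) Hl (Hu lam Hl)) as [b [Hb [Eb [Em _]]]].
      destruct (mass_expansion lam b Hl Hb Eb) as [o [Eo Ho]].
      rewrite Em, Eo.
      replace (_ - 1) with o by (field; lra); exact Ho.
    * auto_derive; easy.
    * ring.
  + intros lam Hl; field; lra.
(* Since [b < 2], the mass [lam / (2 * b ^ 2)] is at least [lam / 8]. *)
- apply (is_lim_le_p_loc (fun lam => / 8 * lam)).
  + exists 0; intros lam Hl.
    destruct (is_solution_explicit lam (u lam) Hl (Hu lam Hl)) as [b [Hb [_ [-> _]]]].
    rewrite Rmult_comm; apply Rmult_le_compat_l; [lra|].
    apply Rinv_le_contravar; nra.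
  + replace p_infty with (Rbar_mult (/ 8) p_infty) at 2.
    * apply is_lim_scal_l, is_lim_id.
    * apply is_Rbar_mult_unique, is_Rbar_mult_sym, is_Rbar_mult_p_infty_pos; simpl; lra.
- intros K HK HK1.
  destruct (compact_below_one K HK HK1) as [rho [Hrho HKr]].
  set (M := 14400 * (1 + tan (PI / 2 * rho)) ^ 4).
  assert (M0 : 0 <= M).
  { apply Rmult_le_pos; [lra|].
    replace ((1 + tan (PI / 2 * rho)) ^ 4) with (((1 + tan (PI / 2 * rho)) ^ 2) ^ 2) by ring.
    apply pow2_ge_0. }
  assert (B : forall lam, 0 < lam -> is_finite (C1_norm K (remainder u lam)) /\
     0 <= real (C1_norm K (remainder u lam)) <= M * ((/ lam) ^ 3 + (/ lam) ^ 4)).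
  { intros lam Hl.
    assert (He : 0 < / lam) by now apply Rinv_0_lt_compat.
    apply C1_norm_bound.
    - apply Rmult_le_pos; [exact M0|].
      apply Rplus_le_le_0_compat; apply pow_le; lra.
    - intros r Kr; apply remainder_C1_bound; [exact Hl|now apply Hu|apply Hrho|now apply HKr]. }
  split; [intros lam Hl; now apply B|].
  (* The factor [lam ^ 2] lowers the powers 3 and 4 of [/ lam] to 1 and 2. *)
  apply (is_lim_zero_of_bound _ (fun e => M * (e + e ^ 2))).
  + intros lam Hl; destruct (B lam Hl) as [_ [N0 NB]].
    rewrite Rabs_pos_eq by (apply Rmult_le_pos; [apply pow2_ge_0|exact N0]).
    replace (M * (/ lam + (/ lam) ^ 2))
      with (lam ^ 2 * (M * ((/ lam) ^ 3 + (/ lam) ^ 4))) by (field; lra).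
    apply Rmult_le_compat_l; [apply pow2_ge_0|exact NB].
  + auto_derive; easy.
  + ring.
- exact is_limit_solution_U.
- exact is_limit_solution_unique.
Qed.
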